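(* Let $E$ be a Banach space and $\tau$ a Hausdorff topology on $E$ such that the norm of $E$ is $\tau$-lower semicontinuous. Let $C$ be a nonempty $\tau$-compact, convex and bounded subset of $E$, and let $\mathcal{S}$ be a commuting family of $\tau$-continuous nonexpansive mappings $C\to C$. Then the set $\mathrm{Fix}\,\mathcal{S}$ of common fixed points of $\mathcal{S}$ is a nonempty nonexpansive retract of $C$.
   Context: The norm is $\tau$-lower semicontinuous if $\|\tau\text{-}\lim_\alpha x_\alpha\|\le\liminf_\alpha\|x_\alpha\|$ for every $\tau$-convergent net $(x_\alpha)_\alpha\subset E$. A mapping $T:C\to C$ is nonexpansive if $\|Tx-Ty\|\le\|x-y\|$ for all $x,y\in C$. A family (possibly infinite) is commuting if $ST=TS$ for all its members $S,T$. $\mathrm{Fix}\,\mathcal{S}=\{x\in C:Tx=x\text{ for all }T\in\mathcal{S}\}$. A nonempty set $D\subset C$ is a nonexpansive retract of $C$ if there exists a nonexpansive mapping $R:C\to D$ whose restriction to $D$ is the identity.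
   Formalization: The formal theorem additionally assumes that subtraction (x,y) ↦ x−y is τ-continuous (true of every linear topology); for an arbitrary Hausdorff topology τ unrelated to the linear structure, the claim as stated is false. *)

(* Defs.v *)
From HB Require Import structures.
From mathcomp Require Import all_boot all_order all_algebra.
From mathcomp Require Import all_classical all_reals all_analysis.

Set Implicit Arguments.
Unset Strict Implicit.
Unset Printing Implicit Defensive.

Import Order.TTheory GRing.Theory Num.Theory.
Import numFieldNormedType.Exports.

Local Open Scope classical_set_scope.
Local Open Scope ring_scope.

Record topology_on (T : Type) := TopologyOn {
  is_open : set (set T) ;
  is_openT : is_open setT ;
  is_openI : setI_closed is_open ;
  is_open_bigU : forall (I : Type) (f : I -> set T),
    (forall i, is_open (f i)) -> is_open (\bigcup_i f i) }.

(* The group E with the topology tau in place of the one it may already carry: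
   E itself is going to be a normed space, whose canonical topology is that of
   the norm. *)
Definition retop (E : zmodType) (tau : topology_on E) : Type := E.

HB.instance Definition _ (E : zmodType) (tau : topology_on E) :=
  GRing.Zmodule.copy (retop tau) E.
HB.instance Definition _ (E : zmodType) (tau : topology_on E) :=
  isOpenTopological.Build (retop tau)
    (is_openT tau) (@is_openI _ tau) (@is_open_bigU _ tau).

Lemma open_retopE (E : zmodType) (tau : topology_on E) (A : set (retop tau)) :
  open A <-> is_open tau A.
Proof. by []. Qed.

Section nets.

Definition directed (I : Type) (le : I -> I -> Prop) : Prop :=
  [/\ inhabited I,
      forall i, le i i,
      forall i j k, le i j -> le j k -> le i k &
      forall i j, exists k, le i k /\ le j k].

Definition net_cvg (X : topologicalType) (I : Type) (le : I -> I -> Prop)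
    (u : I -> X) (x : X) : Prop :=
  forall V, nbhs x V -> exists i, forall j, le i j -> V (u j).

Definition net_liminf (R : realType) (I : Type) (le : I -> I -> Prop)
    (a : I -> R) : \bar R :=
  ereal_sup [set ereal_inf [set (a j)%:E | j in [set j | le i j]]
            | i in [set: I]].

End nets.

Section nonexpansive.
Context {R : realType} {E : normedModType R}.
Implicit Types (C D : set E) (S : set (E -> E)).

Definition norm_lsc (tau : topology_on E) : Prop :=
  forall (I : Type) (le : I -> I -> Prop) (u : I -> E) (x : E),
    directed le -> @net_cvg (retop tau) I le u x ->
    (`|x|%R%:E <= net_liminf le (fun i => `|u i|%R))%E.

(* A map C -> C is represented by a map E -> E, whose values outside C are
   irrelevant, together with the hypothesis that it sends C to C. *)

Definition nonexpansive_on C (T : E -> E) : Prop :=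
  forall x y, C x -> C y -> `|T x - T y| <= `|x - y|.

Definition commuting_on C S : Prop :=
  forall T U, S T -> S U -> forall x, C x -> T (U x) = U (T x).

Definition Fix C S : set E := [set x | C x /\ forall T, S T -> T x = x].

Definition nonexpansive_retract C D : Prop :=
  [/\ D !=set0, D `<=` C &
      exists r : E -> E,
        [/\ set_fun C D r, nonexpansive_on C r & forall x, D x -> r x = x]].

End nonexpansive.

(* Main.v *)
(* The set of nonexpansive self-maps of C is compact for pointwise
   tau-convergence, because closed balls are tau-closed; so limits of
   nonexpansive maps along an ultrafilter exist and are nonexpansive.
   If r is a nonexpansive retraction of C onto a tau-closed set D that T maps to
   itself, let z_t(x) be the fixed point of z |-> t x + (1 - t) T (r z).  Since
   r fixes T (r z), the point r z_t(x) of D is moved by T by at most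
   t |x - T (r z_t(x))|.  A limit of r o z_t as t tends to 0 is therefore a
   nonexpansive retraction of C onto the fixed points of T in D: only T has to
   be tau-continuous, not r.  By commutation this applies to one map of S after
   another, starting from D = C.  A limit of the retractions onto the common
   fixed point sets of the finite subfamilies gives the case of an arbitrary
   S. *)

Require Import Defs.
From HB Require Import structures.
From mathcomp Require Import all_boot all_order all_algebra.
From mathcomp Require Import all_classical all_reals all_analysis.
From mathcomp Require Import lra.

Set Implicit Arguments.
Unset Strict Implicit.
Unset Printing Implicit Defensive.

Import Order.TTheory GRing.Theory Num.Theory.
Import numFieldNormedType.Exports.

Local Open Scope classical_set_scope.
Local Open Scope ring_scope.

(** * Ultrafilters, closedness and limits for [tau] *)

Lemma fmap_ultra (T U : Type) (f : T -> U) (G : set_system T) :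
  UltraFilter G -> UltraFilter (f @ G).
Proof.
move=> GU; split; first exact: fmap_proper_filter.
move=> H HF sH; apply/seteqP; split=> A; last exact: sH.
move=> HA; have [//|GnA] := in_ultra_setVsetC (f @^-1` A) GU.
by have [y []] := filter_ex (filterI HA (sH (~` A) GnA)).
Qed.

Section tau_compact.
Context (R : realType) (E : completeNormedModType R) (tau : topology_on E).
Hypothesis tau_hausdorff : hausdorff_space (retop tau).
Hypothesis tau_sub : continuous (fun p : retop tau * retop tau => p.1 - p.2).
Hypothesis tau_norm : norm_lsc tau.
Variable C : set E.
Hypothesis C_compact : compact (C : set (retop tau)).

Let tau_closed (A : set E) := closed (A : set (retop tau)).

Let tau_closed_limit (I : Type) (F : set_system I) {FF : ProperFilter F}
    (A : set E) (u : I -> E) (x : E) :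
  tau_closed A -> (\forall i \near F, A (u i)) ->
  (u : I -> retop tau) @ F --> (x : retop tau) -> A x.
Proof.
move=> clA FA ux; exact: (@closed_cvg _ (retop tau) F FF u A clA FA x ux).
Qed.

(** Semicontinuity speaks of nets, so a point of the closure is reached by a net indexed by its
    neighbourhoods under reverse inclusion. *)
Lemma norm_le_closed (c : R) : tau_closed [set x | `|x| <= c].
Proof.
move=> x clx.
pose nbhd := {V : set (retop tau) | nbhs (x : retop tau) V}.
have [u uP] : {u : nbhd -> E & forall V, `|u V| <= c /\ sval V (u V)}.
  apply: (@choice nbhd E (fun V y => `|y| <= c /\ sval V y)) => -[V xV].
  by have [y [yc Vy]] := clx V xV; exists y.
pose le (V W : nbhd) := sval W `<=` sval V.
have dir_le : directed le.
  split.
  - by split; exists setT; exact: filterT.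
  - by move=> V y.
  - by move=> V W Z VW WZ; exact: subset_trans WZ VW.
  - move=> [V xV] [W xW]; exists (exist _ _ (filterI xV xW)).
    by split=> y [].
have ux : net_cvg (le : nbhd -> nbhd -> Prop) (u : nbhd -> retop tau) x.
  by move=> V xV; exists (exist _ V xV) => W; apply; case: (uP W).
rewrite /= -lee_fin; apply: le_trans (tau_norm dir_le ux) _.
(* The infimum over the tail from [V] is at most the term at [V], hence at most [c]. *)
apply: ge_ereal_sup => _ [V _ <-]; apply: ereal_inf_le.
exists `|u V|%:E; last by rewrite lee_fin; case: (uP V).
by exists V => //= y.
Qed.

Let cvg_sub (I : Type) (F : set_system I) {FF : ProperFilter F}
    (u v : I -> retop tau) (x y : retop tau) :
  u @ F --> x -> v @ F --> y -> (fun i => u i - v i) @ F --> x - y.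
Proof.
move=> ux vy.
exact: (cvg_comp _ _ (cvg_pair ux vy) (@tau_sub (x, y))).
Qed.

Lemma cvg_norm_sub_le (I : Type) (F : set_system I)
    {FF : ProperFilter F} (u v : I -> E) (x y : E) (c : R) :
  (u : I -> retop tau) @ F --> (x : retop tau) ->
  (v : I -> retop tau) @ F --> (y : retop tau) ->
  (\forall i \near F, `|u i - v i| <= c) -> `|x - y| <= c.
Proof.
move=> ux vy uvc.
apply: (@tau_closed_limit _ _ _ _ (fun i => u i - v i) (x - y)
  (@norm_le_closed c) uvc).
exact: (cvg_sub ux vy).
Qed.

(** An ultrafilter on [C] converging to [x] in norm has a [tau]-limit [y] in [C]; bounds on
    distances pass to [tau]-limits, so [y] is at distance 0 from [x]. Banach's fixed point theorem
    will need this. *)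
Lemma tau_compact_norm_closed : closed C.
Proof.
move=> x clx.
have wC : ProperFilter (within C (nbhs x)) by exact: within_nbhs_proper.
have [G [GU sG]] := ultraFilterLemma wC.
have GC : G C by apply: sG; exact: withinT.
move: C_compact; rewrite compact_ultra => /(_ G GU GC)[y [Cy Gy]].
suff -> : x = y by [].
apply/eqP; rewrite -subr_eq0 -normr_le0.
apply/ler_addgt0Pl => e e0; rewrite addr0 distrC.
apply: (@cvg_norm_sub_le _ G _ id (fun=> x) y x e Gy).
  exact: (@cvg_cst (retop tau)).
apply: sG; apply: (@cvg_within _ _ (nbhs_filter x)).
by near=> z; near: z; apply: (@cvgr_distC_le _ _ _ (nbhs x) _ id x cvg_id e e0).
Unshelve. all: end_near. Qed.

(** One ultrafilter refining [F] serves all points of [C] at once; compactness gives a limit at each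
    of them. Membership in [tau]-closed sets is all that is used of the limit map later. *)
Lemma nonexpansive_limit (I : Type) (F : set_system I)
    {FF : ProperFilter F} (f : I -> E -> E) :
  (\forall i \near F, set_fun C C (f i) /\ nonexpansive_on C (f i)) ->
  exists g : E -> E, nonexpansive_on C g /\
    forall (A : set E) x, C x -> tau_closed A ->
      (\forall i \near F, A (f i x)) -> A (g x).
Proof.
move=> Ff; have [G [GU sG]] := ultraFilterLemma FF.
have [g gP] : {g : E -> E & forall x, C x ->
    (f ^~ x : I -> retop tau) @ G --> (g x : retop tau)}.
  apply: (@choice E E (fun x y => C x ->
    (f ^~ x : I -> retop tau) @ G --> (y : retop tau))) => x.
  have [Cx|nCx] := pselect (C x); last by exists x.
  have GC : (f ^~ x @ G) C.
    by apply: sG; apply: filterS Ff => i [fC _]; exact: fC.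
  have := C_compact.
  by rewrite compact_ultra => /(_ _ (fmap_ultra _ GU) GC)[y [Cy Gy]]; exists y.
exists g; split=> [x y Cx Cy|A x Cx clA FA].
  apply: (cvg_norm_sub_le (gP x Cx) (gP y Cy)).
  by apply: sG; apply: filterS Ff => i [_ fne]; exact: fne.
by apply: (tau_closed_limit clA _ (gP x Cx)); exact: sG.
Qed.

Lemma approx_fix_closed (T : E -> E) (e : R) :
  {within (C : set (retop tau)), continuous (T : retop tau -> retop tau)} ->
  tau_closed [set x | C x /\ `|x - T x| <= e].
Proof.
move=> /subspace_continuousP cT x.
rewrite closureEcvg => -[G GG [Gx sG]].
have GA : G [set x | C x /\ `|x - T x| <= e] by exact: sG.
have GC : G C by apply: filterS GA => z [].
have Cx : C x.
  by apply: (tau_closed_limit (compact_closed tau_hausdorff C_compact) GC).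
split=> //; apply: (@cvg_norm_sub_le _ G _ id T) => //; last first.
  by apply: filterS GA => z [].
(* Since [G] contains [C], it refines the trace on [C] of the neighbourhoods of [x], where [T] is
   continuous. *)
apply: cvg_trans (cT x Cx); apply: cvg_app.
by move=> P xP; apply: filterS (filterI GC (Gx _ xP)) => z [Cz]; exact.
Qed.
End tau_compact.

(** * Solutions of the implicit equation z = t x + (1 - t) K z *)

Lemma implicit_mean_exists (R : realType) (E : completeNormedModType R)
    (C : set E) (K : E -> E) (t : R) (x : E) :
  closed C -> convex_set C -> set_fun C C K -> nonexpansive_on C K ->
  0 < t < 1 -> C x ->
  exists2 z, C z & z = t *: x + (1 - t) *: K z.
Proof.
move=> clC cvC KC Kne /andP[t0 t1] Cx.
have fC : set_fun C C (fun z => t *: x + (1 - t) *: K z).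
  move=> z Cz; have := cvC x (K z) (Itv01 (ltW t0) (ltW t1)).
  by rewrite !inE; apply => //; exact: KC.
have t1' : 0 <= 1 - t by rewrite subr_ge0 ltW.
(* Averaging with the constant [x] makes the nonexpansive [K] a contraction of ratio 1 - t. *)
have ctr : is_contraction (mkfun_fun fC).
  exists (NngNum t1'); split; first by rewrite /= gtrBl.
  move=> [y z] [/= Cy Cz]; rewrite /mkfun opprD addrACA subrr add0r.
  rewrite -scalerBr normrZ ger0_norm// ler_wpM2l//; exact: Kne.
by have [z Cz zE] := banach_fixed_point ctr clC (ex_intro _ x Cx); exists z.
Qed.

Section nonexpansive_resolvent.
Context (R : realType) (E : completeNormedModType R) (C : set E) (K : E -> E).
Variables (t : R) (z : E -> E).
Hypotheses (t01 : 0 < t < 1) (Kne : nonexpansive_on C K).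
Hypotheses (zC : set_fun C C z)
  (zE : forall x, C x -> z x = t *: x + (1 - t) *: K (z x)).

Let t0 : 0 < t. Proof. by case/andP: t01. Qed.

Let t1 : 0 <= 1 - t. Proof. by case/andP: t01 => _ /ltW; rewrite subr_ge0. Qed.

Lemma resolvent_nonexpansive : nonexpansive_on C z.
Proof.
move=> x y Cx Cy; rewrite -(ler_pM2l t0).
have zxy : `|z x - z y| <= t * `|x - y| + (1 - t) * `|z x - z y|.
  rewrite {1}zE// {1}[z y]zE// opprD addrACA -!scalerBr.
  rewrite (le_trans (ler_normD _ _))// !normrZ gtr0_norm// ger0_norm//.
  by rewrite lerD2l ler_wpM2l//; apply: Kne; exact: zC.
(* The term with factor 1 - t is absorbed on the left, leaving the factor t on both sides. *)
lra.
Qed.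

(** A fixed point [x] of [K] solves its own equation, and the factor 1 - t < 1 makes the solution
    unique. *)
Lemma resolvent_fix x : C x -> K x = x -> z x = x.
Proof.
move=> Cx Kx; apply/eqP; rewrite -subr_eq0 -normr_le0.
have zx : `|z x - x| <= (1 - t) * `|z x - x|.
  have {1}-> : z x - x = (1 - t) *: (K (z x) - K x).
    rewrite {1}zE// Kx scalerBr [(1 - t) *: x]scalerBl scale1r.
    by rewrite opprB addrCA addrA.
  by rewrite normrZ ger0_norm// ler_wpM2l//; apply: Kne => //; exact: zC.
rewrite -(ler_pM2l t0) mulr0; lra.
Qed.

Lemma resolvent_sub x : C x -> z x - K (z x) = t *: (x - K (z x)).
Proof.
move=> Cx; rewrite {1}zE// scalerBl scale1r scalerBr.
by rewrite addrA addrAC addrK.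
Qed.

End nonexpansive_resolvent.

(** * Retractions onto fixed point sets: one map, finite families, arbitrary families *)

Section retracts.
Context (R : realType) (E : completeNormedModType R) (tau : topology_on E).
Hypothesis tau_hausdorff : hausdorff_space (retop tau).
Hypothesis tau_sub : continuous (fun p : retop tau * retop tau => p.1 - p.2).
Hypothesis tau_norm : norm_lsc tau.
Variable C : set E.
Hypotheses (C0 : C !=set0) (C_compact : compact (C : set (retop tau))).
Hypotheses (C_convex : convex_set C) (C_bounded : bounded_set C).

Let tau_continuous (T : E -> E) :=
  {within (C : set (retop tau)), continuous (T : retop tau -> retop tau)}.

Lemma nonexpansive_retract_fix (D : set E) (T : E -> E) :
  nonexpansive_retract C D -> closed (D : set (retop tau)) ->
  set_fun C C T -> set_fun D D T -> tau_continuous T -> nonexpansive_on C T ->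
  nonexpansive_retract C (D `&` [set x | T x = x]).
Proof.
move=> [D0 DC [r [rD rne rid]]] clD TC TD Tc Tne.
pose K := T \o r.
have KD x : C x -> D (K x) by move=> /rD/TD.
have KC : set_fun C C K by move=> x /KD/DC.
have Kne : nonexpansive_on C K.
  move=> x y Cx Cy; apply: le_trans (rne _ _ Cx Cy).
  by apply: Tne; apply/DC/rD.
have clC := tau_compact_norm_closed tau_sub tau_norm C_compact.
have [z zP] : {z : R -> E -> E & forall t, 0 < t < 1 -> set_fun C C (z t) /\
    forall x, C x -> z t x = t *: x + (1 - t) *: K (z t x)}.
  have [z zP] : {z : R * E -> E & forall p, 0 < p.1 < 1 -> C p.2 ->
      C (z p) /\ z p = p.1 *: p.2 + (1 - p.1) *: K (z p)}.
    apply: (@choice (R * E) E (fun p y => 0 < p.1 < 1 -> C p.2 ->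
      C y /\ y = p.1 *: p.2 + (1 - p.1) *: K y)) => -[t x] /=.
    have [[t01 Cx]|h] := pselect (0 < t < 1 /\ C x); last first.
      by exists x => t01 Cx; case: h.
    have [y Cy yE] := implicit_mean_exists clC C_convex KC Kne t01 Cx.
    by exists y.
  exists (fun t x => z (t, x)) => t t01; split=> x Cx.
    by have [] := zP (t, x) t01 Cx.
  by have [] := zP (t, x) t01 Cx.
have near01 : \forall t \near (0 : R)^'+, 0 < t < 1.
  near=> t; apply/andP; split; near: t; first exact: nbhs_right_gt.
  exact: nbhs_right_lt.
have [|g [gne gP]] := nonexpansive_limit tau_sub tau_norm C_compact
    (F := (0:R)^'+) (f := fun t x => r (z t x)).
  apply: filterS near01 => t t01; have [zC zE] := zP t t01.
  split=> [x Cx|x y Cx Cy]; first exact/DC/rD/zC.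
  apply: le_trans (resolvent_nonexpansive t01 Kne zC zE Cx Cy).
  by apply: rne; exact: zC.
have gD : set_fun C (D `&` [set x | T x = x]) g.
  move=> x Cx; split.
    apply: gP => //; apply: filterS near01 => t t01.
    by have [zC zE] := zP t t01; exact/rD/zC.
  have [M M0 CM] := ex_strict_bound_gt0 C_bounded.
  apply/esym/eqP; rewrite -subr_eq0 -normr_le0.
  apply/ler_addgt0Pl => e e0; rewrite addr0.
  suff [] : [set x | C x /\ `|x - T x| <= e] (g x) by [].
  apply: gP => //; first exact: approx_fix_closed.
  near=> t; have t01 : 0 < t < 1 by near: t.
  have [zC zE] := zP t t01.
  have Cz : C (z t x) by exact: zC.
  split; first exact/DC/rD.
  (* Thus the displacement of [r (z t x)] under [T] is a difference of two values of [r], at most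
     the distance from [z t x] to [K (z t x)]. *)
  have rK : r (K (z t x)) = K (z t x) by apply/rid/KD.
  have := rne _ _ Cz (KC _ Cz); rewrite rK => /le_trans; apply.
  rewrite (resolvent_sub zE)// normrZ.
  have /andP[t0 t1] := t01; rewrite gtr0_norm//.
  have : `|x - K (z t x)| <= M + M.
    rewrite (le_trans (ler_normB _ _))// lerD// ltW//; apply: CM => //.
    exact: KC.
  move=> /(ler_wpM2l (ltW t0))/le_trans; apply.
  (* As [C] has norm bound [M], it is enough that t <= e / (2 M). *)
  rewrite -ler_pdivlMr ?addr_gt0//; near: t; apply: nbhs_right_ltW.
  by rewrite divr_gt0 ?addr_gt0.
split.
- by have [c Cc] := C0; exists (g c); exact: gD.
- by move=> x [/DC].
exists g; split=> // x [Dx Tx].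
(* Here [K x = x], so [r (z t x) = x] for all small t, and the singleton of [x] is [tau]-closed. *)
apply: (gP [set x] x) => //; first exact: DC.
  exact/accessible_closed_set1/hausdorff_accessible.
apply: filterS near01 => t t01; have [zC zE] := zP t t01.
have Cx := DC _ Dx.
by rewrite /= (resolvent_fix t01 Kne zC zE Cx) ?rid//= /K/= rid.
Unshelve. all: end_near. Qed.

Variable S : set (E -> E).
Hypotheses (S_fun : forall T, S T -> set_fun C C T)
  (S_continuous : forall T, S T -> tau_continuous T)
  (S_nonexpansive : forall T, S T -> nonexpansive_on C T)
  (S_commuting : commuting_on C S).

Lemma Fix_closed (S' : set (E -> E)) :
  S' `<=` S -> closed (Fix C S' : set (retop tau)).
Proof.
move=> S'S.
(* The approximate fixed point sets with e = 0; the extra factor [C] covers an empty [S']. *)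
have -> : Fix C S' =
    C `&` \bigcap_(T in S') [set x | C x /\ `|x - T x| <= 0].
  apply/seteqP; split=> x [Cx xP]; split=> // T S'T.
    by split; rewrite //= xP// subrr normr0.
  have [_] := xP T S'T; rewrite normr_le0 subr_eq0 => /eqP; exact: esym.
apply: (@closedI (retop tau)); first exact: compact_closed.
apply: (@closed_bigI (retop tau)) => T /S'S/S_continuous Tc.
exact: approx_fix_closed.
Qed.

Lemma nonexpansive_retract_Fix_seq (s : seq (E -> E)) :
  (forall T, List.In T s -> S T) ->
  nonexpansive_retract C (Fix C [set T | List.In T s]).
Proof.
elim: s => [_|T s IH sS].
  have -> : Fix C [set T | List.In T [::]] = C by apply/seteqP; split=> x // [].
  by split=> //; exists id; split.
have ST : S T by apply: sS; left.
have sS' U : List.In U s -> S U by move=> sU; apply: sS; right.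
have -> : Fix C [set U | List.In U (T :: s)] =
    Fix C [set U | List.In U s] `&` [set x | T x = x].
  apply/seteqP; split=> x.
    move=> [Cx xP]; split; last by apply: xP; left.
    by split=> // U sU; apply: xP; right.
  by move=> [[Cx xP] Tx]; split=> // U /= [<-//|]; exact: xP.
apply: nonexpansive_retract_fix; [exact: IH|exact: Fix_closed|exact: S_fun| |
  exact: S_continuous|exact: S_nonexpansive].
(* Commutation makes [T] preserve the common fixed points of [s]: U (T x) = T (U x) = T x. *)
move=> x [Cx xP]; split; first exact: S_fun.
by move=> U sU; rewrite (S_commuting (sS' _ sU) ST Cx) xP.
Qed.

Lemma nonexpansive_retract_Fix : nonexpansive_retract C (Fix C S).
Proof.
pose fin_sub : set (seq (E -> E)) := [set s | forall T, List.In T s -> S T].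
(* The tails of the finite subfamilies of [S] directed by inclusion; concatenation gives upper
   bounds. *)
pose above (s : seq (E -> E)) : set (seq (E -> E)) :=
  [set s' | fin_sub s' /\ forall T, List.In T s -> List.In T s'].
pose F := filter_from fin_sub above.
have FF : ProperFilter F.
  apply: filter_from_proper; last by move=> s sS; exists s.
  apply: filter_from_filter; first by exists [::].
  move=> s s' sS s'S; exists (s ++ s') => [T|s2 [s2S s2P]].
    by rewrite List.in_app_iff => -[/sS|/s'S].
  by split; split=> // T sT; apply/s2P/List.in_app_iff; [left|right].
have Fsub : F fin_sub by exists [::] => // s [].
have [r rP] : {r : seq (E -> E) -> E -> E & forall s, fin_sub s ->
    [/\ set_fun C (Fix C [set T | List.In T s]) (r s), nonexpansive_on C (r s)
      & forall x, Fix C [set T | List.In T s] x -> r s x = x]}.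
  apply: (@choice (seq (E -> E)) (E -> E) (fun s r => fin_sub s ->
    [/\ set_fun C (Fix C [set T | List.In T s]) r, nonexpansive_on C r
      & forall x, Fix C [set T | List.In T s] x -> r x = x])) => s.
  have [sS|nsS] := pselect (fin_sub s); last by exists id => /nsS.
  by have [_ _ [r rP]] := nonexpansive_retract_Fix_seq sS; exists r.
have [|g [gne gP]] := nonexpansive_limit tau_sub tau_norm C_compact
    (F := F) (f := r).
  apply: filterS Fsub => s /rP[rC rne _]; split=> // x Cx.
  by have [] := rC x Cx.
have gFix : set_fun C (Fix C S) g.
  move=> x Cx.
  have gT T : S T -> Fix C [set T] (g x).
    move=> ST; apply: (gP (Fix C [set T])) => //.
      by apply: Fix_closed => U ->.
    (* From the list of [T] alone onwards, every retraction takes its values among the fixed points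
       of [T]. *)
    exists [:: T] => [U [<-|]//|s [/rP[rC _ _] sT]].
    have [Crx rxP] := rC x Cx; split=> // U ->.
    by apply/rxP/sT; left.
  split=> [|T ST]; last by have [_] := gT T ST; apply.
  (* Membership in [C] is shown separately because [S] may be empty. *)
  apply: (gP C x) => //; first exact: compact_closed.
  by apply: filterS Fsub => s /rP[rC _ _]; have [] := rC x Cx.
split.
- by have [c Cc] := C0; exists (g c); exact: gFix.
- by move=> x [].
exists g; split=> // x [Cx xP]; apply: (gP [set x] x) => //.
  exact/accessible_closed_set1/hausdorff_accessible.
apply: filterS Fsub => s sS; have [_ _ rid] := rP s sS.
by apply: rid; split=> // T /sS; exact: xP.
Qed.

End retracts.

Theorem theorem2p16 (R : realType) (E : completeNormedModType R)
    (tau : topology_on E)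
    (tau_hausdorff : hausdorff_space (retop tau))
    (tau_sub : continuous (fun p : retop tau * retop tau => p.1 - p.2))
    (tau_norm : norm_lsc tau)
    (C : set E)
    (C0 : C !=set0)
    (C_compact : compact (C : set (retop tau)))
    (C_convex : convex_set C)
    (C_bounded : bounded_set C)
    (S : set (E -> E))
    (S_fun : forall T, S T -> set_fun C C T)
    (S_continuous : forall T, S T ->
      {within (C : set (retop tau)), continuous (T : retop tau -> retop tau)})
    (S_nonexpansive : forall T, S T -> nonexpansive_on C T)
    (S_commuting : commuting_on C S) :
  nonexpansive_retract C (Fix C S).
Proof.
exact: (nonexpansive_retract_Fix tau_hausdorff tau_sub tau_norm C0 C_compact
  C_convex C_bounded S_fun S_continuous S_nonexpansive S_commuting).
Qed.
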